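(* Let $\mu_{\min}<\mu_{\max}$ be real numbers, $\mathcal{P}=[\mu_{\min},\mu_{\max}]$, let $g:\mathbb{R}\to\mathbb{R}$ be given by $g(x)=0$ for $x<0$ and $g(x)=1$ for $x\ge0$, and let $$\mathcal{F}:=\{(x,t)\mapsto g(x-\mu t)\ :\ \mu\in\mathcal{P}\}$$ be the set of solutions, as functions on $\mathbb{R}\times(0,1)$, of the parametric transport problem $u_t+\mu u_x=0$ for $0<t<1$, $x\in\mathbb{R}$, with $u(x,0)=g(x)$. Then the Kolmogorov $n$-width of $\mathcal{F}$ satisfies $$d_n(\mathcal{F})\sim n^{-1},$$ i.e. there are constants $0<c_1\le c_2<\infty$, independent of $n$, such that $c_1n^{-1}\le d_n(\mathcal{F})\le c_2n^{-1}$ for all integers $n\ge1$.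
   Context: The Kolmogorov $n$-width is $$d_n(\mathcal{F})=\inf_{\dim Y=n}\ \sup_{u\in\mathcal{F}}\ \inf_{\phi\in Y}\|u-\phi\|_{L_1},$$ where $\|\cdot\|_{L_1}$ is the $L_1$-norm on $\mathbb{R}\times(0,1)$ (Lebesgue measure in $(x,t)$). Since the elements of $\mathcal{F}$ are not integrable on $\mathbb{R}\times(0,1)$ (only their differences are), $Y$ ranges over all $n$-dimensional linear subspaces of the space $L_{1,\mathrm{loc}}(\mathbb{R}\times(0,1))$ of locally integrable functions, and $\|w\|_{L_1}:=+\infty$ if $w$ is not integrable. *)

(* Defs.v *)
From mathcomp Require Import all_boot all_order all_algebra.
From mathcomp Require Import all_classical all_reals all_analysis.
Import Order.TTheory GRing.Theory Num.Theory.
Import numFieldNormedType.Exports.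

Set Implicit Arguments.
Unset Strict Implicit.
Unset Printing Implicit Defensive.

Local Open Scope classical_set_scope.
Local Open Scope ring_scope.

Notation plane R := (measurableTypeR R * measurableTypeR R)%type.

Definition lebesgue2 (R : realType) : {measure set (plane R) -> \bar R} :=
  (@lebesgue_measure R \x @lebesgue_measure R)%E.

(* Functions on the strip R x (0,1) are represented by total functions on
   R * R, in the variables (x, t), all of whose uses below only involve their
   values on the strip. *)
Definition strip (R : realType) : set (plane R) := setT `*` `]0, 1[.

(* Elements are Borel-measurable representatives; every Lebesgue-measurable
   class has one. *)
Definition L1loc (R : realType) : set (R * R -> R) :=
  [set w | measurable_fun (@strip R) (w : plane R -> R) /\
    forall K : set (R * R), compact K -> K `<=` @strip R ->
      (@lebesgue2 R).-integrable K (EFin \o w)].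

Definition L1norm (R : realType) (w : R * R -> R) : \bar R :=
  if `[< (@lebesgue2 R).-integrable (@strip R) (EFin \o w) >]
  then (\int[@lebesgue2 R]_(z in @strip R) `|w z|%:E)%E
  else +oo%E.

Definition eq_ae_strip (R : realType) (u v : R * R -> R) : Prop :=
  {ae @lebesgue2 R, forall z, @strip R z -> u z = v z}.

(* Elements of L_{1,loc} are classes modulo equality almost everywhere on the
   strip.  A linear subspace is represented by the set of all representatives
   of its elements, hence the saturation clause. *)
Definition linear_subspace (R : realType) (Y : set (R * R -> R)) : Prop :=
  [/\ Y `<=` @L1loc R,
      Y (fun=> 0),
      forall (a : R) u v, Y u -> Y v -> Y (fun z => a * u z + v z) &
      forall u v, Y u -> @L1loc R v -> eq_ae_strip u v -> Y v].

(* Existence of a basis with n elements, linear independence and generation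
   being understood modulo equality almost everywhere. *)
Definition has_dim (R : realType) (n : nat) (Y : set (R * R -> R)) : Prop :=
  exists e : 'I_n -> R * R -> R,
    [/\ forall i, Y (e i),
        forall c : 'I_n -> R,
          eq_ae_strip (fun z => \sum_(i < n) c i * e i z) (fun=> 0) ->
          forall i, c i = 0 &
        forall u, Y u -> exists c : 'I_n -> R,
          eq_ae_strip u (fun z => \sum_(i < n) c i * e i z)].

Definition kolmogorov_width (R : realType) (F : set (R * R -> R)) (n : nat)
    : \bar R :=
  ereal_inf [set ereal_sup [set ereal_inf [set L1norm (fun z => u z - phi z)
                                          | phi in Y]
                           | u in F]
            | Y in [set Y | linear_subspace Y /\ has_dim n Y]].

Definition jump (R : realType) (x : R) : R := if x < 0 then 0 else 1.

Definition transport_solutions (R : realType) (mu_min mu_max : R)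
    : set (R * R -> R) :=
  [set (fun z : R * R => jump (z.1 - mu * z.2)) | mu in `[mu_min, mu_max]].

(* Main.v *)
Require Import Defs.
From mathcomp Require Import all_boot all_order all_algebra.
From mathcomp Require Import all_classical all_reals all_analysis.
From mathcomp Require Import lra ring measurable_realfun.
Import Order.TTheory GRing.Theory Num.Theory.

Local Open Scope ring_scope.

(** Write [u_mu] for the solution with speed [mu], [D] for the length of the
    parameter interval.  For [a <= b] the difference [u_a - u_b] is, on the
    strip, the indicator function of the wedge between the lines [x = a t] and
    [x = b t], whose area [(b - a) / 2] is, up to a constant factor, [b - a]
    ([lebesgue2_wedge], [transport_diff]).

    Upper bound: let [Y] be spanned by [n] solutions with speeds equally spaced
    by [D / n].  Every [u_mu] is within [D / n] of one of them
    ([L1norm_transport_diff]).  [Y] does have dimension [n]: between two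
    consecutive lines a linear combination takes as its value a partial sum of
    the coefficients, so all partial sums vanish if the combination does
    ([transport_free]).

    Lower bound ([approx_lower_bound]): take [n + 2] speeds [mu_0, mu_1, ...],
    equally spaced by [h = D / (n + 1)], and elements [phi_i] of the
    [n]-dimensional space [Y] with [|| u_i - phi_i || < delta].  The [n + 1]
    differences [phi_i - phi_(i+1)] are linearly dependent, say with
    coefficients [c_i].  The wedges [W_i] that carry [u_i - u_(i+1)] are
    disjoint, so that
      [sum |c_i| |W_i| = || sum c_i (u_i - u_(i+1)) ||
         = || sum c_i ((u_i - phi_i) - (u_(i+1) - phi_(i+1))) ||
        <= sum |c_i| (2 delta)].
    Hence some wedge has area at most [2 delta], that is, [delta] is bounded
    below by a constant times [h]. *)

Section transport_width.
Import numFieldNormedType.Exports.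
Local Set Implicit Arguments.
Local Unset Strict Implicit.
Local Unset Printing Implicit Defensive.
Local Open Scope classical_set_scope.
Local Open Scope ring_scope.
Context {R : realType}.
Implicit Types a b mu : R.

(** * Wedges between characteristics *)

Definition transport mu : plane R -> R := fun z => jump (z.1 - mu * z.2).

Definition wedge a b : set (plane R) :=
  [set z | (0 < z.2 < 1) && (a * z.2 <= z.1 < b * z.2)].

Lemma measurable_strip : measurable (@strip R).
Proof. by apply: measurableX => //; exact: measurable_itv. Qed.

Lemma measurable_scaled_time mu :
  measurable_fun setT (fun z : plane R => mu * z.2).
Proof. by apply: measurable_funM. Qed.

Lemma measurable_transport mu : measurable_fun setT (transport mu).
Proof.
rewrite /transport /jump; apply: measurable_fun_ifT => //.
apply: measurable_fun_ltr => //.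
by apply: measurable_funB => //; exact: measurable_scaled_time.
Qed.

Lemma measurable_wedge a b : measurable (wedge a b).
Proof.
rewrite /wedge -[X in measurable X]setTI.
apply: (_ : measurable_fun setT
  (fun z : plane R => (0 < z.2 < 1) && (a * z.2 <= z.1 < b * z.2))) => //.
by apply: measurable_and; apply: measurable_and;
  (apply: measurable_fun_ltr || apply: measurable_fun_ler) => //;
  exact: measurable_scaled_time.
Qed.

Lemma lebesgue_wedge_section a b t : a <= b ->
  lebesgue_measure (ysection (wedge a b) t) =
  if 0 < t < 1 then ((b - a) * t)%:E else 0%E.
Proof.
move=> ab; rewrite ysectionE /wedge/=.
case: ifPn => [|t01]; last first.
  by rewrite (_ : _ @^-1` _ = set0) ?measure0// -subset0 => x /=; rewrite (negbTE t01).
move=> /[dup] t01 /andP[t0 t1].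
rewrite (_ : _ @^-1` _ = `[a * t, b * t[%classic); last first.
  by apply/seteqP; split => x /=; rewrite ?t01 in_itv.
rewrite lebesgue_measure_itv/= lte_fin -EFinB -mulrBl ltr_pM2r//.
by case: ltgtP ab => // -> _; rewrite subrr mul0r.
Qed.

(** The horizontal section at height [t] has length [(b - a) t].  The exact area
    [(b - a) / 2] is not computed: the section length is at most [b - a], and at
    least [(b - a) / 2] in the upper half of the strip. *)
Lemma lebesgue2_wedge a b : a <= b ->
  (((b - a) / 4)%:E <= lebesgue2 R (wedge a b) <= (b - a)%:E)%E.
Proof.
move=> ab; have ba0 : 0 <= b - a by rewrite subr_ge0.
have -> : lebesgue2 R (wedge a b) =
    (\int[lebesgue_measure]_t lebesgue_measure (ysection (wedge a b) t))%E.
  rewrite /lebesgue2.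
  apply: (@product_measure_unique _ _ _ _ R (@lebesgue_measure R)
    (@lebesgue_measure R) ((@lebesgue_measure R) \x^ (@lebesgue_measure R))%E).
    by move=> A B mA mB; exact: product_measure2E.
  exact: measurable_wedge.
have mf : measurable_fun setT (fun t : measurableTypeR R =>
    lebesgue_measure (ysection (wedge a b) t)).
  by apply: measurable_fun_ysection; exact: measurable_wedge.
(* Both bounds compare the section length with a multiple of the indicator
   function of an interval, whose integral [itvE] gives. *)
have itvE (c d k : R) : c < d -> 0 <= k ->
    (k * (d - c))%:E = (\int[@lebesgue_measure R]_t
       (k%:E * (\1_(`]c, d[%classic) t)%:E))%E.
  move=> cd k0; rewrite ge0_integralZl//.
    rewrite integral_indic// setIT EFinM; congr (_ * _)%E.
    by have /= -> := lebesgue_measure_itv `]c, d[; rewrite lte_fin cd.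
  by apply/measurable_EFinP.
apply/andP; split.
- rewrite (_ : _ / 4 = ((b - a) / 2) * (1 - 1 / 2)); last by lra.
  rewrite itvE; [|lra|lra].
  apply: ge0_le_integral => //.
  + by move=> t _; rewrite -EFinM lee_fin mulr_ge0// divr_ge0.
  + by apply: measurable_funeM; exact/measurable_EFinP.
  + move=> t _; rewrite lebesgue_wedge_section// indicE mem_setE in_itv/= -EFinM.
    case: ifPn => t01; last first.
      rewrite (_ : _ < t < _ = false) ?mulr0//.
      by apply: contraNF t01 => /andP[t1 ->]; rewrite (lt_trans _ t1).
    rewrite lee_fin -mulrA ler_wpM2l//.
    by case: (boolP (1 / 2 < t < 1)) => ?; rewrite ?mulr1 ?mulr0; lra.
- rewrite (_ : b - a = (b - a) * (1 - 0)); last by lra.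
  rewrite itvE//; apply: ge0_le_integral => //.
  + by apply: measurable_funeM; exact/measurable_EFinP.
  + move=> t _; rewrite lebesgue_wedge_section// indicE mem_setE in_itv/= -EFinM.
    case: ifPn => t01; rewrite lee_fin ?mulr0// mulr1.
    by rewrite ler_piMr//; lra.
Qed.

Lemma wedge_strip a b : wedge a b `<=` @strip R.
Proof. by move=> [x t] /andP[t01 _]; split => //=; rewrite in_itv. Qed.

Lemma transport_diff a b z : a <= b -> @strip R z ->
  transport a z - transport b z = \1_(wedge a b) z.
Proof.
case: z => x t ab [_ /=]; rewrite in_itv/= => t01.
have t0 : 0 <= t by case/andP: t01 => /ltW.
have abt : a * t <= b * t by rewrite ler_wpM2r.
have -> : \1_(wedge a b) (x, t) = (a * t <= x < b * t)%R%:R :> R.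
  by rewrite indicE (_ : _ \in _ = (a * t <= x < b * t))//; apply/idP/idP;
    rewrite inE /wedge/= t01.
rewrite /transport /jump/= !subr_lt0.
case: (ltP x (a * t)) => xa; case: (ltP x (b * t)) => xb //=; lra.
Qed.

Lemma L1norm_transport_diff a b :
  (L1norm (fun z => transport a z - transport b z)%R <= `|a - b|%:E)%E.
Proof.
have mS := measurable_strip.
have mD : measurable_fun (@strip R)
    (fun z : plane R => transport a z - transport b z).
  by apply: measurable_funTS; apply: measurable_funB; exact: measurable_transport.
have intE : (\int[@lebesgue2 R]_(z in @strip R)
    `|(transport a z - transport b z)%R|%:E <= `|a - b|%:E)%E.
  wlog ab : a b mD / a <= b => [H|].
    have [ab|/ltW ba] := leP a b; first exact: H.
    rewrite distrC; under eq_integral do rewrite distrC.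
    apply: H => //.
    by apply: measurable_funTS; apply: measurable_funB; exact: measurable_transport.
  rewrite (eq_integral (fun z => (\1_(wedge a b) z)%:E)); last first.
    by move=> z /set_mem Sz; rewrite transport_diff// ger0_norm.
  rewrite integral_indic//; last exact: measurable_wedge.
  rewrite setIidl; last exact: wedge_strip.
  rewrite distrC ger0_norm ?subr_ge0//.
  by have /andP[] := lebesgue2_wedge ab.
rewrite /L1norm; case: asboolP => // -[].
apply/integrableP; split; first exact/measurable_EFinP.
exact: le_lt_trans intE (ltry _).
Qed.

(** * Local integrability *)

(** Lebesgue measure on the plane is a product measure, on the product of the two
    Borel sigma-algebras; open sets belong to it because they are countable
    unions of rational rectangles. *)
Lemma open_measurable_plane (U : set (R * R)) :
  open U -> measurable (U : set (plane R)).
Proof.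
move=> oU.
pose rect (q : rat * rat * rat * rat) : set (R * R) :=
  `]ratr q.1.1.1, ratr q.1.1.2[ `*` `]ratr q.1.2, ratr q.2[.
rewrite (_ : U = \bigcup_q (if `[< rect q `<=` U >] then rect q else set0)).
  apply: countable_bigcupT_measurable => //= q.
  by case: ifPn => // _; apply: measurableX; exact: measurable_itv.
apply/seteqP; split => [[x t] Uxt|z [q _]]; last first.
  by case: asboolP => // qU; exact: qU.
have /nbhs_ballP[e /= e0 eU] : nbhs (x, t) U by exact: open_nbhs_nbhs.
have near_rat (y : R) : exists q : rat * rat,
    (y \in `]ratr q.1, ratr q.2[) /\
      `]ratr q.1, ratr q.2[ `<=` ball y e.
  have [|p py] := @rat_in_itvoo _ (y - e) y; first by rewrite ltrBlDr ltrDl.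
  have [|q qy] := @rat_in_itvoo _ y (y + e); first by rewrite ltrDl.
  move: py qy; rewrite !in_itv/= => /andP[? ?] /andP[? ?].
  exists (p, q); split => /=; first by rewrite in_itv/=; apply/andP.
  move=> w /=; rewrite in_itv/= => /andP[? ?].
  by rewrite /ball/= ltr_norml; lra.
have [[p q] [/= xpq pqx]] := near_rat x.
have [[r s] [/= trs rst]] := near_rat t.
exists (p, q, r, s) => //; case: asboolP => // -[] [x' t'] [/= /pqx ? /rst ?].
exact: eU.
Qed.

Lemma compact_measurable_plane (K : set (R * R)) :
  compact K -> measurable (K : set (plane R)).
Proof.
move=> /compact_closed cK; rewrite -[K]setCK.
apply: measurableC; apply: open_measurable_plane; apply: closed_openC.
by apply: cK; exact: norm_hausdorff.
Qed.

Lemma compact_lebesgue2_lty (K : set (R * R)) :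
  compact K -> (@lebesgue2 R K < +oo)%E.
Proof.
move=> cK; have [M [_ KM]] := compact_bounded cK.
pose r := `|M| + 1.
apply: (@le_lt_trans _ _ (@lebesgue2 R (`[- r, r] `*` `[- r, r]))).
  apply: le_measure; rewrite ?inE.
  - exact: compact_measurable_plane.
  - by apply: measurableX; exact: measurable_itv.
  - move=> [x t] Kxt; have : `|(x, t)| <= r.
      by apply: KM => //; rewrite /r (le_lt_trans (ler_norm _))// ltrDl.
    by rewrite prod_normE/= ge_max !ler_norml => /andP[? ?]; split => /=; rewrite in_itv.
rewrite [ltLHS](@product_measure1E _ _ _ _ R (@lebesgue_measure R)
  (@lebesgue_measure R))//; try exact: measurable_itv.
have := @lebesgue_measure_itv R `[- r, r] => /= ->.
by case: ifPn => // _; rewrite -?EFinD -?EFinM ?mule0 ltry.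
Qed.

Lemma L1loc_lincomb a u v : @L1loc R u -> @L1loc R v ->
  @L1loc R (fun z => a * u z + v z).
Proof.
move=> [mu iu] [mv iv]; split.
  by apply: measurable_funD => //; apply: measurable_funM.
move=> K cK KS; have mK := compact_measurable_plane cK.
rewrite (_ : _ \o _ = (fun z => a%:E * (u z)%:E) \+ (EFin \o v))%E.
  by apply: integrableD => //; [apply: integrableZl => //; exact: iu|exact: iv].
by apply/funext => z /=; rewrite EFinD EFinM.
Qed.

Lemma L1loc_bounded (u : plane R -> R) (M : R) : measurable_fun setT u ->
  (forall z, `|u z| <= M) -> @L1loc R u.
Proof.
move=> mu uM; split; first exact: measurable_funTS.
move=> K cK _; apply: measurable_bounded_integrable.
- exact: compact_measurable_plane.
- exact: compact_lebesgue2_lty.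
- exact: measurable_funTS.
- exists M; split; first by rewrite num_real.
  by move=> x Mx z _ /=; rewrite (le_trans (uM z))// ltW.
Qed.

Lemma L1loc0 : @L1loc R (fun=> 0).
Proof. by apply: (@L1loc_bounded _ 0) => // z; rewrite normr0. Qed.

Lemma L1loc_transport mu : @L1loc R (transport mu).
Proof.
apply: (@L1loc_bounded _ 1); first exact: measurable_transport.
by move=> z; rewrite /transport /jump; case: ifP; rewrite ?normr0 ?normr1.
Qed.

(** * The upper bound *)

(** Used to evaluate, at one point of a wedge, an identity that holds almost
    everywhere. *)
Lemma ae_witness (P A : set (plane R)) : measurable A ->
  (0 < @lebesgue2 R A)%E -> {ae @lebesgue2 R, forall z, P z} ->
  exists2 z, A z & P z.
Proof.
move=> mA A0 aeP; apply: contrapT => nAP.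
have : (@lebesgue2 R).-negligible A.
  by apply: negligibleS aeP => z Az Pz; apply: nAP; exists z.
by move/(measure_negligible mA) => A0'; rewrite A0' ltxx in A0.
Qed.

(** Between the lines of speeds [mu k] and [mu k.+1] the solutions with index at
    most [k] equal 1 and the others vanish.  By strong induction only [c k] is
    then left of the combination on this wedge. *)
Lemma transport_free (mu : nat -> R) n (c : 'I_n -> R) :
  {homo mu : i j / (i < j)%N >-> i < j} ->
  eq_ae_strip (fun z => \sum_(i < n) c i * transport (mu i) z) (fun=> 0) ->
  forall i, c i = 0.
Proof.
move=> mu_lt c0 [k]; elim/ltn_ind: k => k IH kn.
have muS : mu k < mu k.+1 by exact: mu_lt.
have [z Wz] : exists2 z, wedge (mu k) (mu k.+1) z &
    (@strip R z -> \sum_(i < n) c i * transport (mu i) z = 0).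
  apply: ae_witness c0; first exact: measurable_wedge.
  have /andP[+ _] := lebesgue2_wedge (ltW muS).
  by apply: lt_le_trans; rewrite lte_fin divr_gt0// subr_gt0.
move=> /(_ (wedge_strip Wz)).
case: z Wz => x t /andP[/= /andP[t0 t1] /andP[kx xk]].
rewrite (bigD1 (Ordinal kn))//= big1 => [|i /negP ik].
  by rewrite /transport /jump/= subr_lt0 ltNge kx mulr1 addr0.
have [ik'|ki] := ltnP i k.
  case: i ik ik' => i Hi ik ik'; by rewrite IH ?mul0r.
have {}ki : (k < i)%N.
  by rewrite ltn_neqAle ki andbT; apply/eqP => ki'; apply: ik; apply/eqP/val_inj.
rewrite /transport /jump/= subr_lt0 (lt_le_trans xk) ?mulr0//.
rewrite ler_wpM2r ?(ltW t0)//.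
by move: ki; rewrite leq_eqVlt => /predU1P[->//|/mu_lt/ltW].
Qed.

(** Saturated under equality almost everywhere, since a subspace is the set of all
    representatives of its elements. *)
Definition ae_span n (e : 'I_n -> R * R -> R) : set (R * R -> R) :=
  [set w | @L1loc R w /\ exists c : 'I_n -> R,
    eq_ae_strip w (fun z => \sum_(i < n) c i * e i z)].

Lemma ae_span_subspace n (e : 'I_n -> R * R -> R) : linear_subspace (ae_span e).
Proof.
split.
- by move=> w [].
- split; first exact: L1loc0.
  exists (fun=> 0); apply: aeW => z _.
  by rewrite big1// => i _; rewrite mul0r.
- move=> a u v [Lu [c uc]] [Lv [d vd]]; split; first exact: L1loc_lincomb.
  exists (fun i => a * c i + d i); apply: filterS2 uc vd => z + + Sz.
  move=> -> // -> //; rewrite mulr_sumr -big_split/=.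
  by apply: eq_bigr => i _; rewrite mulrDl mulrA.
- move=> u v [_ [c uc]] Lv uv; split => //; exists c.
  by apply: filterS2 uc uv => z + + Sz => <- // ->.
Qed.

Lemma mem_ae_span n (e : 'I_n -> R * R -> R) i :
  @L1loc R (e i) -> ae_span e (e i).
Proof.
split=> //; exists (fun j => (j == i)%:R); apply: aeW => z _.
rewrite (bigD1 i)//= eqxx mul1r big1 ?addr0// => j /negbTE ->.
by rewrite mul0r.
Qed.

(** Each node is the left end of one of the [n] intervals of length [h] that make
    up the whole interval. *)
Lemma nearest_node (m h nu : R) n : (0 < n)%N -> 0 <= h -> m <= nu <= m + n%:R * h ->
  exists i : 'I_n, `|nu - (m + i%:R * h)| <= h.
Proof.
move=> + h0; elim: n => // n IH _ /andP[mnu nunh].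
have [nule|ltnu] := leP nu (m + n%:R * h); last first.
  exists ord_max; rewrite ger0_norm /=; first by rewrite -natr1 in nunh; lra.
  by rewrite subr_ge0 ltW.
case: n => [|n] in IH nunh nule *.
  by exists ord0; rewrite (_ : nu = m) ?mul0r ?addr0 ?subrr ?normr0//=; lra.
have [//||i ih] := IH; first by rewrite mnu.
by exists (widen_ord (leqnSn _) i).
Qed.

Lemma kolmogorov_width_le (mu_min mu_max : R) n : mu_min < mu_max -> (0 < n)%N ->
  (kolmogorov_width (transport_solutions mu_min mu_max) n
    <= ((mu_max - mu_min) * n%:R^-1)%:E)%E.
Proof.
move=> lt_mu n0; set h := _ * _.
have n0R : 0 < n%:R :> R by rewrite ltr0n.
have h0 : 0 < h by rewrite mulr_gt0 ?subr_gt0 ?invr_gt0.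
pose node (i : nat) := mu_min + i%:R * h.
pose e (i : 'I_n) : R * R -> R := transport (node i).
have Le i : @L1loc R (e i) by exact: L1loc_transport.
apply: (@le_trans _ _ (ereal_sup [set ereal_inf [set L1norm (fun z => u z - phi z)%R
    | phi in ae_span e] | u in transport_solutions mu_min mu_max])).
  apply: ereal_inf_lbound; exists (ae_span e) => //; split.
    exact: ae_span_subspace.
  exists e; split.
  - by move=> i; exact: mem_ae_span.
  - move=> c; apply: (transport_free (mu := node)) => i j ij.
    by rewrite /node ltrD2l ltr_pM2r// ltr_nat.
  - by move=> u [].
apply: ge_ereal_sup => _ [_ [nu + <-] <-].
rewrite /= in_itv/= => /andP[nu1 nu2].
have [||i hi] := @nearest_node mu_min h nu n n0; first exact: ltW.
  by rewrite nu1/= /h mulrCA divff ?gt_eqF// mulr1 addrC subrK.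
apply: (@le_trans _ _ `|nu - node i|%:E); last by rewrite lee_fin.
apply: le_trans (L1norm_transport_diff nu (node i)).
by apply: ereal_inf_lbound; exists (e i) => //; exact: mem_ae_span.
Qed.

(** * The lower bound *)

Lemma eq_ae_strip_all n (P : 'I_n -> plane R -> Prop) :
  (forall i, {ae @lebesgue2 R, forall z, @strip R z -> P i z}) ->
  {ae @lebesgue2 R, forall z, @strip R z -> forall i, P i z}.
Proof.
move=> aeP.
have : {ae @lebesgue2 R, forall z, forall k : nat,
    @strip R z -> forall i : 'I_n, i = k :> nat -> P i z}.
  apply: ae_foralln => k; have [kn|nk] := ltnP k n.
    apply: filterS (aeP (Ordinal kn)) => z Pz Sz i ik.
    by rewrite (_ : i = Ordinal kn); [exact: Pz|exact: val_inj].
  apply: aeW => z _ i ik; exfalso.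
    by have := ltn_ord i; rewrite ik ltnNge nk.
by apply: filterS => z Pz Sz i; exact: (Pz i Sz i erefl).
Qed.

(** The matrix of coordinates of [n + 1] elements in a basis of [n] elements has a
    nonzero left kernel. *)
Lemma has_dim_dependent n (Y : set (R * R -> R)) (psi : 'I_n.+1 -> R * R -> R) :
  has_dim n Y -> (forall i, Y (psi i)) ->
  exists c : 'I_n.+1 -> R, (exists i, c i != 0) /\
    eq_ae_strip (fun z => \sum_i c i * psi i z) (fun=> 0).
Proof.
move=> [e [_ _ genY]] Ypsi.
have /choice[d psid] i := genY _ (Ypsi i).
pose M : 'M[R]_(n.+1, n) := \matrix_(i, k) d i k.
have kerM : kermx M != 0.
  by rewrite kermx_eq0 -row_leq_rank -ltnNge ltnS rank_leq_col.
pose v := nz_row (kermx M).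
have v0 : v != 0 by rewrite nz_row_eq0.
have vM : v *m M = 0 by apply/sub_kermxP; exact: nz_row_sub.
exists (fun i => v 0 i); split; first exact/rV0Pn.
move/eq_ae_strip_all : psid; apply: filterS => z psiE Sz.
under eq_bigr do rewrite (psiE Sz) mulr_sumr.
rewrite exchange_big big1//= => k _.
under eq_bigr do rewrite mulrA.
rewrite -mulr_suml; move/matrixP/(_ 0 k) : vM; rewrite !mxE.
by under eq_bigr do rewrite mxE; move=> ->; rewrite mul0r.
Qed.

(** At most one summand is nonzero at each point; integrated, this says that
    indicator functions of disjoint sets behave in [L1] like a scaled [l1]
    basis. *)
Lemma norm_sum_disjoint n (W : nat -> set (plane R)) (c : 'I_n -> R) z :
  trivIset setT W ->
  `|\sum_i c i * \1_(W i) z| = \sum_i `|c i| * \1_(W i) z.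
Proof.
move=> tW; have [[i Wi]|nW] := pselect (exists i : 'I_n, W i z).
  have W0 (j : 'I_n) : j != i -> \1_(W j) z = 0 :> R.
    move=> ji; rewrite indicE memNset// => Wj; case/eqP: ji; apply/val_inj.
    by apply: tW => //; exists z.
  rewrite (bigD1 i)//= [in RHS](bigD1 i)//= !big1 ?addr0.
  - by rewrite normrM (ger0_norm (_ : 0 <= \1_(W i) z)).
  - by move=> j /W0 ->; rewrite mulr0.
  - by move=> j /W0 ->; rewrite mulr0.
have W0 (j : 'I_n) : \1_(W j) z = 0 :> R.
  by rewrite indicE memNset// => Wj; apply: nW; exists j.
by rewrite !big1 ?normr0// => j _; rewrite W0 mulr0.
Qed.

Lemma trivIset_wedge (mu : nat -> R) :
  {homo mu : i j / (i <= j)%N >-> i <= j} ->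
  trivIset setT (fun i => wedge (mu i) (mu i.+1)).
Proof.
move=> mu_le; apply/trivIsetP => i j _ _.
wlog ij : i j / (i < j)%N => [H|_].
  by rewrite neq_lt => /orP[] ij; [|rewrite setIC]; apply: H => //; rewrite neq_lt ij.
rewrite -subset0 => -[x t] [] /andP[/= /andP[t0 t1] /andP[_ xi]].
move=> /andP[/= _ /andP[xj _]].
have : mu i.+1 * t <= mu j * t by rewrite ler_wpM2r ?(ltW t0)// mu_le.
by move=> /(lt_le_trans xi); rewrite ltNge xj.
Qed.

(** The value of [L1norm] at a function that is not integrable is [+oo], so a
    finite bound forces integrability, hence measurability. *)
Lemma L1norm_lt (w : R * R -> R) (d : R) : (L1norm w < d%:E)%E ->
  measurable_fun (@strip R) (w : plane R -> R) /\
  (\int[@lebesgue2 R]_(z in @strip R) `|w z|%:E < d%:E)%E.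
Proof.
rewrite /L1norm; case: asboolP => // /integrableP[/measurable_EFinP mw _] wd.
by split.
Qed.

(** With [C] the sum of the [`|c i|], the dependence between differences of
    approximants gives [C h / 4 <= C (2 delta)], and [C > 0] cancels. *)
Lemma approx_lower_bound a b n (Y : set (R * R -> R)) (delta : R) :
  a < b -> linear_subspace Y -> has_dim n Y ->
  (forall mu, a <= mu <= b ->
    exists2 phi, Y phi & (L1norm (fun z => transport mu z - phi z)%R < delta%:E)%E) ->
  (b - a) / (8 * n.+1%:R) <= delta.
Proof.
move=> ab [_ _ linY _] dimY approx.
have n0R : 0 < n.+1%:R :> R by rewrite ltr0n.
pose h := (b - a) / n.+1%:R.
have h0 : 0 < h by rewrite divr_gt0 ?subr_gt0.
pose mu (i : nat) := a + i%:R * h.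
have mu_le : {homo mu : i j / (i <= j)%N >-> i <= j}.
  by move=> i j ij; rewrite lerD2l ler_wpM2r ?(ltW h0)// ler_nat.
have muS i : mu i.+1 - mu i = h by rewrite /mu -natr1; ring.
have mu_ab i : (i <= n.+1)%N -> a <= mu i <= b.
  move=> ile; rewrite -{1}(_ : mu 0%N = a); last by rewrite /mu mul0r addr0.
  rewrite (_ : b = mu n.+1) ?mu_le//.
  by rewrite /mu /h mulrCA divff ?gt_eqF// mulr1 addrC subrK.
have /choice[phi phiP] (i : nat) : exists phi, (i <= n.+1)%N -> Y phi /\
    (L1norm (fun z => transport (mu i) z - phi z)%R < delta%:E)%E.
  case: (leqP i n.+1) => [/mu_ab/approx[f Yf fd]|_]; last by exists (fun=> 0).
  by exists f.
pose w i : plane R -> R := fun z => transport (mu i) z - phi i z.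
have w_small i : (i <= n.+1)%N -> measurable_fun (@strip R) (w i) /\
    (\int[@lebesgue2 R]_(z in @strip R) `|w i z|%:E < delta%:E)%E.
  by move=> /phiP[_ /L1norm_lt].
have Yd (i : 'I_n.+1) : Y (fun z => -1 * phi i.+1 z + phi i z).
  by apply: linY; [have [] := phiP i.+1 (ltn_ord i)|have [] := phiP i (ltnW (ltn_ord i))].
have [c [[k ck] cphi]] := has_dim_dependent dimY Yd.
have C0 : 0 < \sum_(i < n.+1) `|c i|.
  rewrite (bigD1 k)//= ltr_pwDl ?normr_gt0//.
  by apply: sumr_ge0.
pose W i := wedge (mu i) (mu i.+1).
have mW i : measurable (W i) by exact: measurable_wedge.
have mS := measurable_strip.
(* Pointwise, [f] is the absolute value of [sum c_i (u_i - u_(i+1))], and [g]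
   bounds that of the same sum with the approximants subtracted; the two sums
   agree almost everywhere by the choice of [c]. *)
pose f z := (\sum_(i < n.+1) `|c i|%:E * (\1_(W i) z)%:E)%E.
pose g z := (\sum_(i < n.+1) `|c i|%:E * (`|w i z|%:E + `|w i.+1 z|%:E))%E.
have mf (i : 'I_n.+1) : measurable_fun (@strip R)
    (fun z => `|c i|%:E * (\1_(W i) z)%:E)%E.
  apply: measurable_funeM; apply: measurable_funTS.
  by apply/measurable_EFinP; exact: measurable_indic.
have mw i : (i <= n.+1)%N -> measurable_fun (@strip R) (fun z => `|w i z|%:E).
  move=> /w_small[mw _]; apply/measurable_EFinP.
  by apply: measurableT_comp mw.
have mg (i : 'I_n.+1) : measurable_fun (@strip R)
    (fun z => `|c i|%:E * (`|w i z|%:E + `|w i.+1 z|%:E))%E.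
  apply: measurable_funeM; apply: emeasurable_funD; apply: mw => //.
  exact: ltnW.
have fg : (\int[@lebesgue2 R]_(z in @strip R) f z <=
           \int[@lebesgue2 R]_(z in @strip R) g z)%E.
  apply: ae_ge0_le_integral => //.
  - by move=> z _; apply: sume_ge0 => i _; rewrite mule_ge0// lee_fin.
  - exact: emeasurable_sum.
  - by move=> z _; apply: sume_ge0 => i _; rewrite mule_ge0// adde_ge0// lee_fin.
  - exact: emeasurable_sum.
  apply: filterS cphi => z cphi Sz.
  rewrite /f /g; under eq_bigr do rewrite -EFinM.
  under [leRHS]eq_bigr do rewrite -EFinD -EFinM.
  rewrite !sumEFin lee_fin -norm_sum_disjoint; last exact: trivIset_wedge.
  rewrite (_ : \sum_i _ = \sum_(i < n.+1) c i * (w i z - w i.+1 z)).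
    apply: (le_trans (ler_norm_sum _ _ _)); apply: ler_sum => i _.
    by rewrite normrM ler_wpM2l// ler_normB.
  apply: subr0_eq; rewrite -[RHS](cphi Sz) /= -sumrB; apply: eq_bigr => i _.
  rewrite -transport_diff//; last exact: mu_le.
  by rewrite /w; ring.
move: fg; rewrite ge0_integral_sum//.
rewrite ge0_integral_sum//; last first.
  by move=> i z _; rewrite mule_ge0// adde_ge0// lee_fin.
move=> fg.
have lef : ((\sum_(i < n.+1) `|c i| * (h / 4))%:E <=
    \sum_(i < n.+1) \int[@lebesgue2 R]_(z in @strip R)
      (`|c i|%:E * (\1_(W i) z)%:E))%E.
  rewrite -sumEFin; apply: lee_sum => i _.
  rewrite ge0_integralZl//; [|by apply: measurable_funTS; apply/measurable_EFinP..].
  rewrite EFinM lee_pmul//; first by rewrite lee_fin divr_ge0// ltW.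
  rewrite integral_indic// setIidl; last exact: wedge_strip.
  by have /andP[] := lebesgue2_wedge (mu_le _ _ (leqnSn i)); rewrite muS.
have geg : (\sum_(i < n.+1) \int[@lebesgue2 R]_(z in @strip R)
      (`|c i|%:E * (`|w i z|%:E + `|w i.+1 z|%:E)) <=
    (\sum_(i < n.+1) `|c i| * (delta + delta))%:E)%E.
  rewrite -sumEFin; apply: lee_sum => i _.
  have il : (i <= n.+1)%N by exact: ltnW.
  rewrite ge0_integralZl//; last first.
  - by move=> z _; rewrite adde_ge0// lee_fin.
  - by apply: emeasurable_funD; exact: mw.
  rewrite EFinM lee_pmul//.
    by apply: integral_ge0 => z _; rewrite adde_ge0// lee_fin.
  rewrite ge0_integralD//; [|exact: mw..].
  by rewrite EFinD leeD// ltW//; [have [] := w_small i il|have [] := w_small i.+1 (ltn_ord i)].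
have := le_trans lef (le_trans fg geg).
rewrite lee_fin -!mulr_suml ler_pM2l// => hd.
rewrite invfM mulrCA -/h; lra.
Qed.

(** The spacing is [D / (n + 1)], which is at least [D / (2 n)]; with 16
    in place of 32 this would be an equality at [n = 1], where the argument by
    contradiction needs a strict inequality. *)
Lemma kolmogorov_width_ge (mu_min mu_max : R) n : mu_min < mu_max -> (0 < n)%N ->
  (((mu_max - mu_min) / 32 * n%:R^-1)%:E <=
    kolmogorov_width (transport_solutions mu_min mu_max) n)%E.
Proof.
move=> lt_mu n0; have n0R : 1 <= n%:R :> R by rewrite ler1n.
rewrite leNgt; apply/negP => /ereal_inf_lt[_ [Y [linY dimY] <-]] /=.
set s := ereal_sup _ => s_lt.
have s_ge nu : mu_min <= nu <= mu_max ->
    (ereal_inf [set L1norm (fun z => transport nu z - phi z)%R | phi in Y] <= s)%E.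
  by move=> nuP; apply: ereal_sup_ubound; exists (transport nu) => //;
    exists nu => //=; rewrite in_itv.
have : (mu_max - mu_min) / (8 * n.+1%:R) <= (mu_max - mu_min) / 32 * n%:R^-1.
  apply: (approx_lower_bound lt_mu linY dimY) => nu /s_ge/le_lt_trans/(_ s_lt).
  by move=> /ereal_inf_lt[_ [phi Yphi <-]]; exists phi.
rewrite -mulrA -invfM ler_pM2l ?subr_gt0// lef_pV2 ?posrE ?mulr_gt0//; last first.
  by rewrite (lt_le_trans ltr01).
by rewrite -natr1; lra.
Qed.

End transport_width.

Theorem propositionA1 (R : realType) (mu_min mu_max : R)
    (hmu : mu_min < mu_max) :
  exists c1 c2 : R, [/\ 0 < c1, c1 <= c2 &
    forall n : nat, (1 <= n)%N ->
      ((c1 * n%:R^-1)%:E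
         <= kolmogorov_width (transport_solutions mu_min mu_max) n)%E /\
      (kolmogorov_width (transport_solutions mu_min mu_max) n
         <= (c2 * n%:R^-1)%:E)%E].
Proof.
exists ((mu_max - mu_min) / 32), (mu_max - mu_min); split; [lra|lra|].
move=> n n0; split; first exact: kolmogorov_width_ge.
exact: kolmogorov_width_le.
Qed.
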